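(* Let $n\ge 3$, let $\Omega$ be a bounded convex domain of $\mathbb{R}^n$ with $\partial\Omega\in C^3$, and let $\varphi$ be a function on $\partial\Omega$. Let $u\in C^0(\mathbb{R}^n\setminus\Omega)$ be a viscosity solution of $$\det(D^2u)=1\ \text{ in }\mathbb{R}^n\setminus\overline{\Omega},\qquad u=\varphi\ \text{ on }\partial\Omega .$$ Then $\varphi$ is semi-convex with respect to $\partial\Omega$.
   Context: Notation: for $x=(x_1,\dots,x_n)$, $x'=(x_1,\dots,x_{n-1})$; $B'_\delta(0')$ is the open ball in $\mathbb{R}^{n-1}$ of radius $\delta$ centered at $0'$. Locally convex: $u\in C^0(D)$ is locally convex in an open set $D\subset\mathbb{R}^n$ if every $x\in D$ is the center of an open ball $B\subset D$ on which $u$ is convex (equivalently, $u$ is convex in every open ball $B\subset D$). Viscosity solution of $\det(D^2u)=1$ in an open set $D$: let $u\in C^0(D)$ be locally convex. $u$ is a viscosity subsolution if for any $v\in C^2(D)$ and any local maximum point $x_0\in D$ of $u-v$, $\det(D^2v(x_0))\ge 1$. $u$ is a viscosity supersolution if for any locally convex $v\in C^2(D)$ and any local minimum point $x_0\in D$ of $u-v$, $\det(D^2v(x_0))\le 1$. $u$ is a viscosity solution if it is both. Local coordinate system at $\xi\in\partial\Omega$: a coordinate system $(x',x_n)$ chosen such that $x=0$ at $\xi$, the positive $x_n$-axis directs to the interior of $\Omega$, and $\partial\Omega$ is locally represented by the graph $x_n=\rho(x')$ for $|x'|<\delta(\xi)$, for some constant $\delta(\xi)>0$ and a function $\rho:B'_{\delta(\xi)}(0')\to\mathbb{R}$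 with $\rho(0')=0$. Semi-convexity with respect to $\partial\Omega$: $\varphi$ is semi-convex with respect to $\partial\Omega$ at $\xi\in\partial\Omega$ if, in the local coordinate system at $\xi$, the function $\psi(x'):=\varphi(x',\rho(x'))$ is semi-convex in $B'_{\delta(\xi)}(0')$, i.e. there is a constant $K(\xi)>0$ such that $\psi(x')+\frac{K(\xi)}{2}|x'|^2$ is convex in $B'_{\delta(\xi)}(0')$. $\varphi$ is semi-convex with respect to $\partial\Omega$ if this holds at every $\xi\in\partial\Omega$. *)

(* Defs.v *)
(* R^n is rendered as row vectors over R : realType. *)
From HB Require Import structures.
From mathcomp Require Import all_boot all_order all_algebra.
From mathcomp Require Import all_classical all_reals all_analysis.

Set Implicit Arguments.
Unset Strict Implicit.
Unset Printing Implicit Defensive.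

Import Order.TTheory GRing.Theory Num.Theory.
Import numFieldNormedType.Exports.

Local Open Scope classical_set_scope.
Local Open Scope ring_scope.

(* The library norm on 'rV[R]_n is the sup norm: it gives the usual topology,
   but the balls of the paper are Euclidean. *)
Definition enorm (R : realType) (n : nat) (x : 'rV[R]_n) : R :=
  Num.sqrt (\sum_(i < n) x 0 i ^+ 2).

Definition eball (R : realType) (n : nat) (c : 'rV[R]_n) (r : R) :
    set 'rV[R]_n :=
  [set x | enorm (x - c) < r].

Definition boundary (T : topologicalType) (A : set T) : set T :=
  closure A `\` interior A.

Definition domain (T : topologicalType) (A : set T) : Prop :=
  [/\ open A, connected A & A !=set0].

Definition partial (R : realType) (n : nat) (i : 'I_n) (f : 'rV[R]_n -> R) :
    'rV[R]_n -> R :=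
  'D_(delta_mx 0 i) f.

(* Meant for open D; the values of f outside D are irrelevant. *)
Fixpoint Ck (R : realType) (n k : nat) (D : set 'rV[R]_n)
    (f : 'rV[R]_n -> R) : Prop :=
  {in D, continuous f} /\
  if k is k'.+1 then
    forall i : 'I_n,
      {in D, forall x, derivable f x (delta_mx 0 i)} /\ Ck k' D (partial i f)
  else True.

Definition hessian (R : realType) (n : nat) (f : 'rV[R]_n -> R)
    (x : 'rV[R]_n) : 'M[R]_n :=
  \matrix_(i, j) partial j (partial i f) x.

Definition locally_convex (R : realType) (n : nat) (D : set 'rV[R]_n)
    (u : 'rV[R]_n -> R) : Prop :=
  forall x, D x -> exists r : R,
    [/\ 0 < r, eball x r `<=` D & convex_function (eball x r) u].

Definition viscosity_subsolution (R : realType) (n : nat) (D : set 'rV[R]_n)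
    (u : 'rV[R]_n -> R) : Prop :=
  forall v : 'rV[R]_n -> R, Ck 2 D v ->
  forall x0, D x0 -> (\forall x \near x0, u x - v x <= u x0 - v x0) ->
  1 <= \det (hessian v x0).

Definition viscosity_supersolution (R : realType) (n : nat) (D : set 'rV[R]_n)
    (u : 'rV[R]_n -> R) : Prop :=
  forall v : 'rV[R]_n -> R, Ck 2 D v -> locally_convex D v ->
  forall x0, D x0 -> (\forall x \near x0, u x0 - v x0 <= u x - v x) ->
  \det (hessian v x0) <= 1.

Definition viscosity_solution (R : realType) (n : nat) (D : set 'rV[R]_n)
    (u : 'rV[R]_n -> R) : Prop :=
  [/\ {in D, continuous u}, locally_convex D u,
      viscosity_subsolution D u & viscosity_supersolution D u].

(* A Cartesian coordinate system with origin xi: the rows of E are the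
   directions of the x'-axes and e is the direction of the positive x_n-axis. *)
Definition orthonormal_axes (R : realType) (n : nat)
    (E : 'M[R]_(n.-1, n)) (e : 'rV[R]_n) : Prop :=
  [/\ E *m E^T = 1%:M, E *m e^T = 0 & e *m e^T = 1%:M].

Definition from_coord (R : realType) (n : nat) (xi : 'rV[R]_n)
    (E : 'M[R]_(n.-1, n)) (e : 'rV[R]_n) (x' : 'rV[R]_n.-1) (xn : R) :
    'rV[R]_n :=
  xi + x' *m E + xn *: e.

(* "Locally" means in a cylinder |x'| < delta, |x_n| < h.  That Omega lies
   above the graph says that the positive x_n-axis points into Omega. *)
Definition local_graph (R : realType) (n : nat) (Omega : set 'rV[R]_n)
    (xi : 'rV[R]_n) (E : 'M[R]_(n.-1, n)) (e : 'rV[R]_n)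
    (delta : R) (rho : 'rV[R]_n.-1 -> R) : Prop :=
  [/\ orthonormal_axes E e, 0 < delta, rho 0 = 0
    & exists2 h : R, 0 < h &
      forall x', eball 0 delta x' ->
        `|rho x'| < h /\
        forall xn : R, `|xn| < h ->
          (boundary Omega (from_coord xi E e x' xn) <-> xn = rho x') /\
          (Omega (from_coord xi E e x' xn) <-> rho x' < xn)].

Definition Ck_boundary (R : realType) (n k : nat) (Omega : set 'rV[R]_n) :
    Prop :=
  forall xi, boundary Omega xi ->
  exists (E : 'M[R]_(n.-1, n)) (e : 'rV[R]_n) (delta : R)
         (rho : 'rV[R]_n.-1 -> R),
    local_graph Omega xi E e delta rho /\ Ck k (eball 0 delta) rho.

Definition semiconvex (R : realType) (m : nat) (D : set 'rV[R]_m)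
    (psi : 'rV[R]_m -> R) : Prop :=
  exists2 K : R, 0 < K &
    convex_function D (fun x => psi x + K / 2 * enorm x ^+ 2).

(* The condition is required for every choice of the axes of a local coordinate
   system at xi, and for some delta.  It cannot be asked for every delta: rho
   may have unbounded slope near |x'| = delta (as for a hemisphere), and then
   even a linear phi may fail to be semi-convex on the whole ball. *)
Definition semiconvex_wrt_boundary_at (R : realType) (n : nat)
    (Omega : set 'rV[R]_n) (phi : 'rV[R]_n -> R) (xi : 'rV[R]_n) : Prop :=
  forall (E : 'M[R]_(n.-1, n)) (e : 'rV[R]_n),
    (exists delta rho, local_graph Omega xi E e delta rho) ->
    exists delta rho,
      local_graph Omega xi E e delta rho /\
      semiconvex (eball 0 delta)
        (fun x' => phi (from_coord xi E e x' (rho x'))).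

(* Only the values of phi on the boundary matter. *)
Definition semiconvex_wrt_boundary (R : realType) (n : nat)
    (Omega : set 'rV[R]_n) (phi : 'rV[R]_n -> R) : Prop :=
  forall xi, boundary Omega xi -> semiconvex_wrt_boundary_at Omega phi xi.

(* Main.v *)
Require Import Defs.
From HB Require Import structures.
From mathcomp Require Import all_boot all_order all_algebra.
From mathcomp Require Import all_classical all_reals all_analysis.
From mathcomp Require Import zify ring lra.

Set Implicit Arguments.
Unset Strict Implicit.
Unset Printing Implicit Defensive.

Import Order.TTheory GRing.Theory Num.Theory.
Import numFieldNormedType.Exports.

Local Open Scope classical_set_scope.
Local Open Scope ring_scope.

(** A solution is locally convex outside Omega.  The boundary is curved, so this
    does not make the boundary values convex, but the error is controlled by the
    curvature of the boundary.

    Work in local coordinates X(x',s) at a boundary point, with the boundary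
    given by s = rho(x') and Omega above the graph.  Convexity of Omega makes rho
    convex ([graph_convex]).  Let c = t x + (1-t) y.  A line supporting rho over
    the segment [y, x] and touching it at c stays outside Omega, so u is convex
    along the lifted segment ([exterior_convex_below_graph]); its endpoints lie
    over x and y, below the graph.  Going straight down from a boundary point, u
    is again convex, hence it exceeds its boundary value by at most a constant M
    times the depth ([exterior_downward_growth]).  Together, the trace
    psi(x') = u(X(x',rho(x'))) satisfies
      psi(c) <= t psi(x) + (1-t) psi(y) + M (t rho(x) + (1-t) rho(y) - rho(c)),
    that is, psi + M rho is convex: [exterior_trace_convexity_defect].

    It remains to know that K/2 |x'|^2 - M rho is convex for large K, that is,
    that rho is semiconcave.  In the coordinates in which the boundary is known
    to be C^2, this follows from bounds on the pure second partials alone, since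
    a convex function is bounded above by its values along the axes
    ([convex_C2_semiconcave]).  The axes of the conclusion may be others, in
    which no smoothness of rho is given.  The function G = y_n - rho0(y') of the
    smooth coordinates is concave, positive in Omega, zero on the boundary, and
    its concavity defect is quadratic.  By concavity G grows at least linearly
    in the inner axis direction of the other coordinates, so the height of a
    chord of the graph of rho over the graph is at most a constant times the
    value of G on the chord, which is quadratic in the length of the chord
    ([graph_semiconcave]). *)

(** * Convexity in terms of real weights *)

Lemma convex_functionP (R : realType) (n : nat) (D : set 'rV[R]_n)
    (f : 'rV[R]_n -> R) :
  convex_function D f <->
  forall x y t, D x -> D y -> 0 <= t <= 1 ->
    f (t *: x + (1 - t) *: y) <= t * f x + (1 - t) * f y.
Proof.
split=> [fc x y t Dx Dy t01|fc t x y].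
  by have := fc (Itv01 (andP t01).1 (andP t01).2) x y (mem_set Dx) (mem_set Dy).
move=> /set_mem Dx /set_mem Dy.
by apply: (fc x y t%:num) => //; rewrite ge0 le1.
Qed.

Lemma convex_setP (R : realType) (n : nat) (A : set 'rV[R]_n) :
  convex_set A -> forall x y t, A x -> A y -> 0 <= t <= 1 ->
  A (t *: x + (1 - t) *: y).
Proof.
move=> Ac x y t Ax Ay t01.
have := Ac x y (Itv01 (andP t01).1 (andP t01).2) (mem_set Ax) (mem_set Ay).
exact: set_mem.
Qed.

Lemma normr_conv_le (R : realType) (a b m t : R) :
  `|a| <= m -> `|b| <= m -> 0 <= t <= 1 -> `|t * a + (1 - t) * b| <= m.
Proof.
rewrite !ler_norml => /andP[a1 a2] /andP[b1 b2] /andP[t0 t1].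
have t1' : 0 <= 1 - t by lra.
have := ler_wpM2l t0 a1; have := ler_wpM2l t0 a2.
have := ler_wpM2l t1' b1; have := ler_wpM2l t1' b2.
by move=> *; apply/andP; split; lra.
Qed.

Lemma norm_conv_lt (R : realType) (n : nat) (x y : 'rV[R]_n) (t r : R) :
  `|x| < r -> `|y| < r -> 0 <= t <= 1 -> `|t *: x + (1 - t) *: y| < r.
Proof.
move=> xr yr /andP[t0 t1]; have t1' : 0 <= 1 - t by lra.
apply: (le_lt_trans (ler_normD _ _)).
rewrite !normrZ (ger0_norm t0) (ger0_norm t1').
pose m := Num.max `|x| `|y|; have mr : m < r by rewrite gt_max xr.
have xm : `|x| <= m by rewrite le_max lexx.
have ym : `|y| <= m by rewrite le_max lexx orbT.
have := ler_wpM2l t0 xm; have := ler_wpM2l t1' ym; lra.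
Qed.

(** * Convex functions of one variable *)

(** Subtracting the chord and a multiple of s (1 - s) makes the midpoint
    inequality strict, and this excludes an interior maximum. *)
Lemma locally_midconvex_le_chord (R : realType) (g : R -> R) :
  {within `[0, 1], continuous g} ->
  (forall s, 0 < s < 1 -> exists2 d, 0 < d &
     forall e, 0 < e < d -> 2 * g s <= g (s - e) + g (s + e)) ->
  forall t, 0 <= t <= 1 -> g t <= t * g 1 + (1 - t) * g 0.
Proof.
move=> gcont gmid t /andP[t0 t1]; rewrite leNgt; apply/negP => tgt.
have [t00|t0'] := eqVneq t 0; first by move: tgt; rewrite t00; lra.
have [t10|t1'] := eqVneq t 1; first by move: tgt; rewrite t10; lra.
have {}t0 : 0 < t by rewrite lt_neqAle eq_sym t0'.
have {}t1 : t < 1 by rewrite lt_neqAle t1'.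
set m := g t - (t * g 1 + (1 - t) * g 0).
have m0 : 0 < m by rewrite subr_gt0.
pose q s := s * g 1 + (1 - s) * g 0 + m * (s * (1 - s)).
pose k s := g s - q s.
have qcont : continuous q.
  move=> s; rewrite /q; apply: cvgD; first apply: cvgD; apply: cvgM;
    try (apply: cvgM); try (apply: cvgB);
    by [exact: cvg_id|exact: cvg_cst].
have kcont : {within `[0, 1], continuous k}.
  by move=> s; apply: cvgB; [exact: gcont|exact: continuous_subspaceT].
have [c + kmax] := EVT_max ler01 kcont.
rewrite in_itv /= => /andP[c0 c1].
have kt : 0 < k t.
  rewrite /k /q opprD addrA -/m -[X in X - _]mulr1 -mulrBr mulr_gt0 //.
  have : t * (1 - t) <= 1 / 4 by have := sqr_ge0 (t - 1 / 2); rewrite expr2; nra.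
  lra.
have kc : 0 < k c.
  by apply: lt_le_trans kt _; apply: kmax; rewrite in_itv /= !ltW.
have {}c0 : 0 < c.
  rewrite lt_neqAle c0 andbT; apply/eqP => c00; move: kc; rewrite -c00 /k /q; lra.
have {}c1 : c < 1.
  rewrite lt_neqAle c1 andbT; apply/eqP => c00; move: kc; rewrite c00 /k /q; lra.
have [|d d0 gd] := gmid c; first by rewrite c0.
pose e := Num.min (d / 2) (Num.min c (1 - c)).
have e0 : 0 < e by rewrite !lt_min c0 subr_gt0 c1 divr_gt0.
have ed : e < d by rewrite gt_min; apply/orP; left; lra.
have ec : e <= c by rewrite !ge_min lexx !orbT.
have ec1 : e <= 1 - c by rewrite !ge_min lexx !orbT.
have /gd gce : 0 < e < d by rewrite e0.
have k1 : k (c - e) <= k c by apply: kmax; rewrite in_itv /=; lra.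
have k2 : k (c + e) <= k c by apply: kmax; rewrite in_itv /=; lra.
have : m * (e * e) <= 0 by move: k1 k2; rewrite /k /q; lra.
by rewrite leNgt; rewrite !mulr_gt0.
Qed.

(** The slope is the supremum of the slopes of the chords on the left of t. *)
Lemma convex_support_slope (R : realType) (g : R -> R) (t : R) : 0 < t < 1 ->
  (forall a b, 0 <= a < t -> t < b <= 1 ->
     (b - a) * g t <= (b - t) * g a + (t - a) * g b) ->
  exists sigma, forall s, 0 <= s <= 1 -> g t + sigma * (s - t) <= g s.
Proof.
move=> /andP[t0 t1] gc.
pose S := [set (g t - g a) / (t - a) | a in [set a | 0 <= a < t]].
have S0 : S !=set0 by exists ((g t - g 0) / (t - 0)), 0 => //=; rewrite lexx.
have Sle b : t < b <= 1 -> ubound S ((g b - g t) / (b - t)).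
  move=> tb _ [a /= at_ <-].
  have ta : 0 < t - a by lra.
  have bt : 0 < b - t by lra.
  rewrite ler_pdivrMr // mulrAC ler_pdivlMr //.
  have := gc a b at_ tb; lra.
have Sub : has_ubound S by exists ((g 1 - g t) / (1 - t)); apply: Sle; rewrite t1 /=.
exists (sup S) => s /andP[s0 s1]; case: (ltgtP s t) => [st|ts|->]; last lra.
- have : (g t - g s) / (t - s) <= sup S.
    by apply: ub_le_sup => //; exists s => //=; rewrite s0.
  rewrite ler_pdivrMr ?subr_gt0 //; lra.
- have : sup S <= (g s - g t) / (s - t) by apply: ge_sup => //; apply: Sle; lra.
  rewrite ler_pdivlMr ?subr_gt0 //; lra.
Qed.

(** * The sup norm and the Euclidean norm *)

Lemma norm_coord_le (R : realType) (n : nat) (x : 'rV[R]_n) (i : 'I_n) :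
  `|x 0 i| <= `|x|.
Proof.
rewrite [leRHS](mx_normrE x).
exact: (le_bigmax _ (fun ij : 'I_1 * 'I_n => `|x ij.1 ij.2|) (0, i)).
Qed.

Lemma norm_le_coord (R : realType) (n : nat) (x : 'rV[R]_n) (a : R) :
  0 <= a -> (forall i, `|x 0 i| <= a) -> `|x| <= a.
Proof.
move=> a0 xa; rewrite [leLHS](mx_normrE x).
by apply: bigmax_le => // -[j i] _; rewrite [j]ord1.
Qed.

Lemma enorm_ge0 (R : realType) (n : nat) (x : 'rV[R]_n) : 0 <= enorm x.
Proof. exact: sqrtr_ge0. Qed.

Lemma enorm_sqr (R : realType) (n : nat) (x : 'rV[R]_n) :
  enorm x ^+ 2 = \sum_(i < n) x 0 i ^+ 2.
Proof. by rewrite sqr_sqrtr // sumr_ge0 // => i _; exact: sqr_ge0. Qed.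

(** The norm of the space of row vectors is the sup norm.  All estimates are
    made with it, and are carried over to Euclidean balls at the end. *)
Lemma norm_le_enorm (R : realType) (n : nat) (x : 'rV[R]_n) : `|x| <= enorm x.
Proof.
apply: norm_le_coord => [|i]; first exact: enorm_ge0.
rewrite -(ler_pXn2r (ltn0Sn 1)) ?nnegrE ?enorm_ge0 // enorm_sqr.
rewrite (bigD1 i) //= -normrX ger0_norm ?sqr_ge0 // lerDl.
by apply: sumr_ge0 => j _; exact: sqr_ge0.
Qed.

Lemma enorm_sqr_le (R : realType) (n : nat) (x : 'rV[R]_n) :
  enorm x ^+ 2 <= n%:R * `|x| ^+ 2.
Proof.
rewrite enorm_sqr mulr_natl -[X in _ *+ X]card_ord -sumr_const.
apply: ler_sum => i _; rewrite -[x 0 i ^+ 2]ger0_norm ?sqr_ge0 // normrX.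
by rewrite lerXn2r ?nnegrE ?norm_coord_le.
Qed.

Lemma enorm_lt (R : realType) (n : nat) (r : R) : 0 < r ->
  exists2 d, 0 < d & forall x : 'rV[R]_n, `|x| < d -> enorm x < r.
Proof.
move=> r0; have n0 : (0 : R) < n.+1%:R by [].
exists (r / n.+1%:R) => [|x]; first by rewrite divr_gt0.
rewrite ltr_pdivlMr // => xr.
rewrite -(ltr_pXn2r (ltn0Sn 1)) ?nnegrE ?enorm_ge0 ?(ltW r0) //.
apply: (le_lt_trans (enorm_sqr_le x)).
have : (`|x| * n.+1%:R) ^+ 2 < r ^+ 2 by rewrite ltrXn2r ?(ltW r0) ?mulr_ge0.
move=> xr2; apply: (le_lt_trans _ xr2); rewrite exprMn mulrC ler_wpM2l ?sqr_ge0 //.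
by rewrite -natrX ler_nat; lia.
Qed.

(** The exact convexity defect of the squared Euclidean norm, which the term
    K/2 |x|^2 of semi-convexity has to offer. *)
Lemma enorm_sqr_conv (R : realType) (n : nat) (x y : 'rV[R]_n) (t : R) :
  enorm (t *: x + (1 - t) *: y) ^+ 2
    = t * enorm x ^+ 2 + (1 - t) * enorm y ^+ 2
      - t * (1 - t) * enorm (x - y) ^+ 2.
Proof.
rewrite !enorm_sqr !mulr_sumr -big_split -sumrB; apply: eq_bigr => i _ /=.
by rewrite !mxE; ring.
Qed.

Lemma eball0_conv (R : realType) (n : nat) (r : R) (x y : 'rV[R]_n) (t : R) :
  eball 0 r x -> eball 0 r y -> 0 <= t <= 1 ->
  eball 0 r (t *: x + (1 - t) *: y).
Proof.
rewrite /eball /= !subr0 => xr yr /andP[t0 t1].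
have t1' : 0 <= 1 - t by lra.
have r0 : 0 <= r by rewrite (le_trans (enorm_ge0 x)) // ltW.
pose m := Num.max (enorm x) (enorm y).
have mr : m < r by rewrite gt_max xr.
have m0 : 0 <= m by rewrite le_max enorm_ge0.
have xm : enorm x ^+ 2 <= m ^+ 2.
  by rewrite lerXn2r ?nnegrE ?enorm_ge0 // le_max lexx.
have ym : enorm y ^+ 2 <= m ^+ 2.
  by rewrite lerXn2r ?nnegrE ?enorm_ge0 // le_max lexx orbT.
apply: (le_lt_trans _ mr).
rewrite -(ler_pXn2r (ltn0Sn 1)) ?nnegrE ?enorm_ge0 // enorm_sqr_conv.
have := ler_wpM2l t0 xm; have := ler_wpM2l t1' ym.
have := mulr_ge0 (mulr_ge0 t0 t1') (sqr_ge0 (enorm (x - y))).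
lra.
Qed.

Lemma mulmx_bounded (R : realType) (m n : nat) (A : 'M[R]_(m, n)) :
  exists2 B, 0 <= B & forall x : 'rV[R]_m, `|x *m A| <= B * `|x|.
Proof.
have S0 : 0 <= \sum_i \sum_j `|A i j|.
  by apply: sumr_ge0 => i _; exact: sumr_ge0.
exists (\sum_i \sum_j `|A i j|) => // x.
apply: norm_le_coord => [|j]; first exact: mulr_ge0.
rewrite mxE; apply: le_trans (ler_norm_sum _ _ _) _.
rewrite mulr_suml; apply: ler_sum => i _; rewrite normrM mulrC.
apply: ler_pM => //; last exact: norm_coord_le.
by rewrite (bigD1 j) //= lerDl sumr_ge0.
Qed.

(** * Locally convex functions along segments *)

(** The balls of convexity around the points of the segment give the midpoint
    inequality for small steps, hence the inequality for the chord. *)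
Lemma locally_convex_segment (R : realType) (n : nat) (D : set 'rV[R]_n)
    (u : 'rV[R]_n -> R) (x y : 'rV[R]_n) :
  {in D, continuous u} -> Defs.locally_convex D u ->
  (forall t, 0 <= t <= 1 -> D (t *: x + (1 - t) *: y)) ->
  forall t, 0 <= t <= 1 ->
    u (t *: x + (1 - t) *: y) <= t * u x + (1 - t) * u y.
Proof.
move=> ucont uconv Dxy.
pose g t := u (t *: x + (1 - t) *: y).
have pathC t : {for t, continuous (fun t : R => t *: x + (1 - t) *: y)}.
  apply: cvgD; apply: cvgZr_tmp; first exact: cvg_id.
  by apply: cvgB; [exact: cvg_cst|exact: cvg_id].
have gcont t : 0 <= t <= 1 -> {for t, continuous g}.
  move=> /Dxy Dt; apply: continuous_comp; first exact: pathC.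
  by apply: ucont; exact: mem_set.
have := locally_midconvex_le_chord (g := g).
rewrite /g subrr subr0 !scale1r !scale0r addr0 add0r; apply.
  apply: continuous_in_subspaceT => t /set_mem /=; rewrite in_itv /=.
  exact: gcont.
move=> s s01; have Ds : D (s *: x + (1 - s) *: y) by apply: Dxy; lra.
have [r [r0 rD rc]] := uconv _ Ds.
have [d d0 dr] := enorm_lt n r0.
exists (d / (1 + `|x - y|)) => [|e /andP[e0]].
  by rewrite divr_gt0 // ltr_pwDl.
rewrite ltr_pdivlMr ?ltr_pwDl // => ed.
have exy : `|e *: (x - y)| < d.
  apply: (le_lt_trans _ ed); rewrite normrZ gtr0_norm // ler_wpM2l ?(ltW e0) ?lerDr //.
set c := s *: x + (1 - s) *: y in Ds rD rc.
have pathE a : (s + a) *: x + (1 - (s + a)) *: y = c + a *: (x - y).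
  rewrite /c scalerBr; apply/rowP => i; rewrite !mxE; ring.
have in_ball z : `|z| < d -> eball c r (c + z).
  by move=> zd; rewrite /eball /= addrC addKr; exact: dr.
have := (convex_functionP _ _).1 rc (c - e *: (x - y)) (c + e *: (x - y)) (1 / 2).
rewrite pathE -scaleNr pathE => mid.
have : u c <= 1 / 2 * u (c + (- e) *: (x - y))
            + (1 - 1 / 2) * u (c + e *: (x - y)).
  have -> : u c = u (1 / 2 *: (c + (- e) *: (x - y))
            + (1 - 1 / 2) *: (c + e *: (x - y))).
    by congr u; apply/rowP => i; rewrite !mxE; field.
  apply: mid; [apply: in_ball; by rewrite scaleNr normrN|exact: in_ball|lra].
lra.
Qed.

Lemma within_continuous_dist (R : realType) (n : nat) (A : set 'rV[R]_n)
    (u : 'rV[R]_n -> R) :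
  {within A, continuous u} ->
  forall x e, A x -> 0 < e ->
  exists2 d, 0 < d & forall y, A y -> `|y - x| < d -> `|u y - u x| < e.
Proof.
move=> /subspace_continuousP uc x e Ax e0.
have /cvgr_distC_lt /(_ _ e0) := uc x Ax.
rewrite /within /= => /nbhs_normP [d /= d0 dP]; exists d => // y Ay yx.
by apply: dP => //=; rewrite distrC.
Qed.

(** Convexity up to the boundary of the region D of local convexity: the segment
    may touch the boundary of D, as long as small translates of it along - v do
    not, because u is continuous on the larger set A. *)
Lemma convex_segment_limit (R : realType) (n : nat) (A D : set 'rV[R]_n)
    (u : 'rV[R]_n -> R) (x y v : 'rV[R]_n) (a : R) :
  {within A, continuous u} -> {in D, continuous u} ->
  Defs.locally_convex D u -> D `<=` A -> 0 < a ->
  (forall t, 0 <= t <= 1 -> A (t *: x + (1 - t) *: y)) ->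
  (forall t e, 0 <= t <= 1 -> 0 < e < a ->
     D (t *: x + (1 - t) *: y - e *: v)) ->
  forall t, 0 <= t <= 1 ->
    u (t *: x + (1 - t) *: y) <= t * u x + (1 - t) * u y.
Proof.
move=> /within_continuous_dist uA uD uconv DA a0 Axy Dxy t t01.
have [t0 t1] := andP t01.
have Ax : A x by have := Axy 1; rewrite subrr scale1r scale0r addr0; apply; lra.
have Ay : A y by have := Axy 0; rewrite subr0 scale1r scale0r add0r; apply; lra.
apply/ler_addgt0Pr => e e0; have e20 : 0 < e / 2 by lra.
have [dx dx0 ux] := uA _ _ Ax e20.
have [dy dy0 uy] := uA _ _ Ay e20.
have [dc dc0 uc] := uA _ _ (Axy t t01) e20.
pose d := Num.min dx (Num.min dy dc).
have d0 : 0 < d by rewrite !lt_min dx0 dy0.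
have v0 : 0 < 1 + `|v| by rewrite ltr_pwDl.
pose s := Num.min (a / 2) (d / 2 / (1 + `|v|)).
have s0 : 0 < s by rewrite lt_min !divr_gt0.
have sa : s < a by rewrite gt_min; apply/orP; left; lra.
have sv z : `|(z - s *: v) - z| < d.
  rewrite addrAC subrr add0r normrN normrZ gtr0_norm //.
  have : s <= d / 2 / (1 + `|v|) by rewrite ge_min lexx orbT.
  rewrite ler_pdivlMr // mulrDr mulr1 => sd; lra.
have [sx sy sc] : [/\ forall z, `|(z - s *: v) - z| < dx,
    forall z, `|(z - s *: v) - z| < dy & forall z, `|(z - s *: v) - z| < dc].
  by split=> z; have := sv z; rewrite !lt_min => /and3P[].
have Ds k : 0 <= k <= 1 -> D (k *: (x - s *: v) + (1 - k) *: (y - s *: v)).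
  move=> k01; have := Dxy k s k01; rewrite s0 sa => /(_ isT).
  by congr D; apply/rowP => i; rewrite !mxE; ring.
have Dx := Ds 1; rewrite subrr scale1r scale0r addr0 in Dx.
have Dy := Ds 0; rewrite subr0 scale1r scale0r add0r in Dy.
have {}Dx := DA _ (Dx ltac:(lra)); have {}Dy := DA _ (Dy ltac:(lra)).
have Dc := DA _ (Ds t t01).
have := locally_convex_segment uD uconv Ds t01.
have cE : t *: (x - s *: v) + (1 - t) *: (y - s *: v)
    = t *: x + (1 - t) *: y - s *: v.
  by apply/rowP => i; rewrite !mxE; ring.
rewrite cE in Dc *.
have := ux _ Dx (sx _); have := uy _ Dy (sy _); have := uc _ Dc (sc _).
rewrite !ltr_norml => /andP[c1 c2] /andP[y1 y2] /andP[x1 x2] H.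
have := ler_wpM2l t0 (ltW x2); have t1' : 0 <= 1 - t by lra.
have := ler_wpM2l t1' (ltW y2); lra.
Qed.

(** * Lipschitz bounds and supporting lines of convex functions *)

(** Prolong the segment from y to x by the length r / 2 and compare the slopes of
    the two parts. *)
Lemma convex_bounded_lipschitz (R : realType) (n : nat) (r b : R)
    (f : 'rV[R]_n -> R) :
  0 < r -> 0 <= b ->
  (forall x y t, `|x| < r -> `|y| < r -> 0 <= t <= 1 ->
    f (t *: x + (1 - t) *: y) <= t * f x + (1 - t) * f y) ->
  (forall x, `|x| < r -> `|f x| <= b) ->
  forall x y, `|x| < r / 2 -> `|y| < r / 2 ->
    `|f x - f y| <= 4 * b / r * `|x - y|.
Proof.
move=> r0 b0 fc fb.
suff main x y : `|x| < r / 2 -> `|y| < r / 2 ->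
    f x - f y <= 4 * b / r * `|x - y|.
  move=> x y xr yr; rewrite ler_norml; have := main _ _ xr yr.
  by have := main _ _ yr xr; rewrite distrC; lra.
move=> xr yr; have [->|xy] := eqVneq x y; first by rewrite !subrr normr0 mulr0.
set d := `|x - y|; have d0 : 0 < d by rewrite normr_gt0 subr_eq0.
pose a := r / (2 * d); have a0 : 0 < a by rewrite divr_gt0 // mulr_gt0.
have a1 : 0 < 1 + a by lra.
(* z lies at distance r / 2 beyond x *)
pose z := x + a *: (x - y).
have zr : `|z| < r.
  apply: (le_lt_trans (ler_normD _ _)); rewrite normrZ gtr0_norm // -/d.
  have -> : a * d = r / 2 by rewrite /a; field; rewrite gt_eqF.
  lra.
have yr' : `|y| < r by lra.
pose s := (1 + a)^-1.
have s01 : 0 <= s <= 1.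
  by rewrite invr_ge0 ltW //= invf_le1 //; lra.
have := fc z y s zr yr' s01.
have -> : s *: z + (1 - s) *: y = x.
  by apply/rowP => i; rewrite !mxE /s; field; rewrite gt_eqF.
move=> fx.
have := fb _ zr; have := fb _ yr'; rewrite !ler_norml => /andP[y1 y2] /andP[z1 z2].
have : s * (f z - f y) <= s * (2 * b) by rewrite ler_wpM2l; lra.
have : s * (2 * b) <= 4 * b / r * d.
  have -> : 4 * b / r * d = a^-1 * (2 * b).
    by rewrite /a; field; rewrite !gt_eqF.
  rewrite ler_wpM2r ?lef_pV2 ?posrE //; lra.
lra.
Qed.

(** A supporting slope along a single line is enough: it spares a supporting
    hyperplane, and with it any differentiability of f. *)
Lemma convex_line_support (R : realType) (n : nat) (r : R)
    (f : 'rV[R]_n -> R) (x y : 'rV[R]_n) (t : R) :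
  (forall x y t, `|x| < r -> `|y| < r -> 0 <= t <= 1 ->
    f (t *: x + (1 - t) *: y) <= t * f x + (1 - t) * f y) ->
  `|x| < r -> `|y| < r -> 0 < t < 1 ->
  exists sigma, forall s, 0 <= s <= 1 ->
    f (t *: x + (1 - t) *: y) + sigma * (s - t) <= f (s *: x + (1 - s) *: y).
Proof.
move=> fconv xr yr t01.
apply: (@convex_support_slope R (fun s => f (s *: x + (1 - s) *: y))) => // a b.
move=> /andP[a0 at_] /andP[tb b1]; have ab : 0 < b - a by lra.
pose l := (t - a) / (b - a).
have l01 : 0 <= l <= 1.
  apply/andP; split; first by apply: divr_ge0; lra.
  by rewrite ler_pdivrMr // mul1r; lra.
have br : `|b *: x + (1 - b) *: y| < r by apply: norm_conv_lt => //; lra.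
have ar : `|a *: x + (1 - a) *: y| < r by apply: norm_conv_lt => //; lra.
have := fconv _ _ l br ar l01.
have -> : l *: (b *: x + (1 - b) *: y) + (1 - l) *: (a *: x + (1 - a) *: y)
    = t *: x + (1 - t) *: y.
  by apply/rowP => i; rewrite !mxE /l; field; rewrite gt_eqF.
have bal : (b - a) * l = t - a by rewrite /l; field; rewrite gt_eqF.
have bal' : (b - a) * (1 - l) = b - t by rewrite mulrBr mulr1 bal; ring.
move=> /(ler_wpM2l (ltW ab))/le_trans; apply.
by rewrite [leLHS]mulrDr [in leLHS]mulrA bal [in leLHS]mulrA bal' addrC.
Qed.

(** * Semiconcavity of convex functions of class C^2 *)

(** The constant is M rather than M / 2 because the bound comes from two
    applications of the mean value theorem. *)
Lemma taylor2_le (R : realType) (g g1 g2 : R -> R) (a M : R) :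
  (forall s : R, `|s| < a -> is_derive s (1 : R) g (g1 s)) ->
  (forall s : R, `|s| < a -> is_derive s (1 : R) g1 (g2 s)) ->
  (forall s : R, `|s| < a -> `|g2 s| <= M) ->
  forall s, `|s| < a -> g s <= g 0 + s * g1 0 + M * s ^+ 2.
Proof.
move=> dg dg1 g2M s sa.
have inside x y z : `|x| < a -> `|y| < a -> x <= z <= y -> `|z| < a.
  rewrite !ltr_norml => /andP[? ?] /andP[? ?] /andP[? ?]; apply/andP; split; lra.
have a0 : `|0 : R| < a by rewrite normr0; apply: le_lt_trans sa.
have mvt (f df : R -> R) : (forall s : R, `|s| < a -> is_derive s (1 : R) f (df s)) ->
    forall x y, `|x| < a -> `|y| < a -> x <= y ->
    exists2 z, x <= z <= y & f y - f x = df z * (y - x).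
  move=> fdf x y xa ya xy.
  have [|//|z] := MVT_segment (f := f) (df := df) xy.
  - by move=> z; rewrite in_itv /= => /andP[xz zy];
      apply: fdf; apply: (inside x y); rewrite ?ltW.
  - apply: derivable_within_continuous => z; rewrite in_itv /= => xzy.
    by apply: ex_derive; apply: fdf; exact: inside xzy.
  by rewrite in_itv /= => xzy E; exists z.
have [s0|s0] := leP 0 s.
- have [z z0s Ez] := mvt _ _ dg 0 s a0 sa s0.
  have za := inside _ _ _ a0 sa z0s; have [z0 zs] := andP z0s.
  have [w w0z Ew] := mvt _ _ dg1 0 z a0 za z0.
  have := g2M w (inside _ _ _ a0 za w0z); rewrite ler_norml => /andP[wM1 wM2].
  have : g1 z - g1 0 <= M * s by rewrite Ew subr0; nra.
  move=> /(ler_wpM2r s0); lra.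
- have [z zs0 Ez] := mvt _ _ dg s 0 sa a0 (ltW s0).
  have za := inside _ _ _ sa a0 zs0; have [sz z0] := andP zs0.
  have [w wz0 Ew] := mvt _ _ dg1 z 0 za a0 z0.
  have := g2M w (inside _ _ _ za a0 wz0); rewrite ler_norml => /andP[wM1 wM2].
  have : g1 0 - g1 z <= M * - s by rewrite Ew sub0r; nra.
  have s0' : 0 <= - s by lra.
  move=> /(ler_wpM2r s0'); lra.
Qed.

Lemma is_derive_line (R : realType) (n : nat) (f : 'rV[R]_n -> R)
    (c v : 'rV[R]_n) (s : R) :
  derivable f (c + s *: v) v ->
  is_derive s (1 : R) (fun s => f (c + s *: v)) ('D_v f (c + s *: v)).
Proof.
have E : (fun h : R => h^-1 *: (((fun s => f (c + s *: v)) \o shift s) (h *: 1)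
      - f (c + s *: v)))
    = (fun h => h^-1 *: ((f \o shift (c + s *: v)) (h *: v) - f (c + s *: v))).
  apply/funext => h /=; congr (_ *: (f _ - _)).
  by apply/rowP => i; rewrite !mxE /= scaler1; ring.
by move=> df; apply: DeriveDef; rewrite /derivable /derive E.
Qed.

Lemma CkW (R : realType) (n k : nat) (D : set 'rV[R]_n) (f : 'rV[R]_n -> R) :
  Ck k.+1 D f -> Ck k D f.
Proof.
elim: k f => [|k IHk] f [fc fS]; split=> // i.
by have [fi fiC] := fS i; split=> //; exact: IHk.
Qed.

Lemma Ck2_bounded_pure_partials (R : realType) (n : nat) (D : set 'rV[R]_n)
    (f : 'rV[R]_n -> R) (x0 : 'rV[R]_n) : Ck 2 D f -> D x0 ->
  exists d M, [/\ 0 < d, 0 <= M & forall x i, `|x - x0| < d ->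
    `|partial i (partial i f) x| <= M].
Proof.
move=> [_ fC2] Dx0.
pose M := \sum_i (`|partial i (partial i f) x0| + 1).
have M0 : 0 <= M by apply: sumr_ge0 => i _; rewrite addr_ge0.
have near_i i : \forall x \near x0, `|partial i (partial i f) x| <= M.
  have cont : {for x0, continuous (partial i (partial i f))}.
    by case: (fC2 i) => _ [_ /(_ i)[_ [+ _]]]; apply; exact: mem_set.
  apply: (cvgr_norm_le _ cont); rewrite /M (bigD1 i) //= -addrA ltrDl.
  by rewrite ltr_wpDr // sumr_ge0.
have : \forall x \near x0, forall i, `|partial i (partial i f) x| <= M.
  exact: (@filter_forall _ _ _ (nbhs x0) (nbhs_filter x0) near_i).
move=> /nbhs_normP[d /= d0 dP].
exists d, M; split => // x i xd.
by apply: (dP x) => /=; rewrite distrC.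
Qed.

(** Jensen's inequality for equal weights.  The points are indexed by nat so that
    the induction on their number need not change the index type. *)
Lemma convex_average (R : realType) (n : nat) (D : set 'rV[R]_n)
    (f : 'rV[R]_n -> R) (x : nat -> 'rV[R]_n) (k : nat) :
  (forall y z t, D y -> D z -> 0 <= t <= 1 -> D (t *: y + (1 - t) *: z)) ->
  (forall y z t, D y -> D z -> 0 <= t <= 1 ->
     f (t *: y + (1 - t) *: z) <= t * f y + (1 - t) * f z) ->
  (forall i, D (x i)) ->
  D (k.+1%:R^-1 *: \sum_(i < k.+1) x i) /\
  f (k.+1%:R^-1 *: \sum_(i < k.+1) x i)
    <= k.+1%:R^-1 * \sum_(i < k.+1) f (x i).
Proof.
move=> Dc fc Dx; elim: k => [|k [IHD IHf]].
  by rewrite !big_ord_recr !big_ord0 /= !add0r invr1 scale1r mul1r.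
have k1 : (k.+1%:R : R) != 0 by [].
have k2 : (k.+2%:R : R) != 0 by [].
pose t : R := k.+1%:R / k.+2%:R.
have t01 : 0 <= t <= 1.
  by rewrite divr_ge0 //= ler_pdivrMr // mul1r ler_nat.
have tE : 1 - t = k.+2%:R^-1.
  have k2E : (k.+2%:R : R) = k.+1%:R + 1 by rewrite natr1.
  by rewrite /t k2E; field; rewrite !nat1r natr1.
have tk : t / k.+1%:R = k.+2%:R^-1 by rewrite /t mulrAC (divff k1) mul1r.
have avgE : k.+2%:R^-1 *: \sum_(i < k.+2) x i
    = t *: (k.+1%:R^-1 *: \sum_(i < k.+1) x i) + (1 - t) *: x k.+1.
  rewrite big_ord_recr scalerDr tE scalerA /=; congr (_ *: _ + _).
  by rewrite tk.
rewrite avgE; split; first exact: Dc.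
apply: (le_trans (fc _ _ _ IHD (Dx _) t01)).
rewrite [in leRHS]big_ord_recr /= mulrDr tE lerD2r.
apply: le_trans (ler_wpM2l (andP t01).1 IHf) _.
by rewrite mulrA tk.
Qed.

(** With m the dimension, c + h is the average of the points c + m h_i e_i, so
    by convexity f(c + h) is at most the average of the values of f there, and
    each of these is bounded by the one-dimensional Taylor formula, in which
    only pure second partials enter. *)
Lemma convex_C2_quadratic_ub (R : realType) (k : nat) (delta : R)
    (f : 'rV[R]_k.+1 -> R) :
  0 < delta -> Ck 2 (eball 0 delta) f ->
  (forall x y t, eball 0 delta x -> eball 0 delta y -> 0 <= t <= 1 ->
    f (t *: x + (1 - t) *: y) <= t * f x + (1 - t) * f y) ->
  exists r C, [/\ 0 < r, 0 <= C & forall c, `|c| < r ->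
    exists p : 'I_k.+1 -> R, forall h, `|h| < 2 * r ->
      f (c + h) <= f c + \sum_i h 0 i * p i + C * `|h| ^+ 2].
Proof.
move=> delta0 fC2 fconv.
have [d1 d10 d1P] := enorm_lt k.+1 delta0.
have in_ball (x : 'rV[R]_k.+1) : `|x| < d1 -> eball 0 delta x.
  by move=> xd; rewrite /eball /= subr0; exact: d1P.
have [|d2 [M [d20 M0 MP]]] := Ck2_bounded_pure_partials (x0 := 0) fC2.
  by apply: in_ball; rewrite normr0.
pose d := Num.min d1 d2.
have d0 : 0 < d by rewrite lt_min d10.
pose m : R := k.+1%:R; have m1 : 1 <= m by rewrite ler1n.
have m0 : 0 < m by lra.
pose r := d / (1 + 2 * m).
have r0 : 0 < r by rewrite divr_gt0 //; lra.
have dE : d = r + 2 * m * r by rewrite /r; field; rewrite gt_eqF //; lra.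
(* one factor m comes from the steps m h_i, the other from enorm_sqr_le *)
exists r, (M * m ^+ 2); split => // [|c cr].
  by rewrite mulr_ge0 // sqr_ge0.
exists (fun i => partial i f c) => h hr.
pose e i : 'rV[R]_k.+1 := delta_mx 0 i.
have e1 i : `|e i| <= 1.
  by apply: norm_le_coord => // j; rewrite mxE; case: (_ && _); rewrite ?normr1 ?normr0.
have on_axis s i : `|s| < 2 * m * r -> `|c + s *: e i| < d.
  move=> sr; apply: (le_lt_trans (ler_normD _ _)); rewrite normrZ dE.
  by have := ler_wpM2l (normr_ge0 s) (e1 i); lra.
have axis i : f (c + (m * h 0 i) *: e i)
    <= f c + m * h 0 i * partial i f c + M * (m * h 0 i) ^+ 2.
  have [fc fC1] := fC2; have [dfi [_ /(_ i)[dfii _]]] := fC1 i.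
  have := @taylor2_le _ (fun s => f (c + s *: e i))
    (fun s => partial i f (c + s *: e i))
    (fun s => partial i (partial i f) (c + s *: e i)) (2 * m * r) M.
  rewrite scale0r addr0; apply.
  - move=> s sr; apply: is_derive_line; apply: dfi; apply: mem_set.
    by apply: in_ball; have := on_axis s i sr; rewrite lt_min => /andP[].
  - move=> s sr; apply: is_derive_line; apply: dfii; apply: mem_set.
    by apply: in_ball; have := on_axis s i sr; rewrite lt_min => /andP[].
  - move=> s sr; apply: MP; rewrite subr0.
    by have := on_axis s i sr; rewrite lt_min => /andP[].
  - rewrite normrM (gtr0_norm m0) -mulrA mulrCA ltr_pM2l //.
    exact: le_lt_trans (norm_coord_le h i) hr.
have := @convex_average _ _ (fun x => `|x| < d) f
  (fun i => c + (m * h 0 (inord i)) *: e (inord i)) k.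
have -> : k.+1%:R^-1 *: \sum_(i < k.+1) (c + (m * h 0 (inord i)) *: e (inord i))
    = c + h.
  rewrite big_split /= sumr_const card_ord scalerDr -[c *+ _]scaler_nat scalerA.
  rewrite mulVf ?scale1r; last by rewrite gt_eqF.
  congr (_ + _); rewrite [RHS]row_sum_delta scaler_sumr.
  apply: eq_bigr => i _; rewrite inord_val scalerA /m mulrA mulVf ?mul1r //.
case=> //.
- by move=> y z t; exact: norm_conv_lt.
- move=> y z t yd zd t01; apply: fconv => //; apply: in_ball.
    by move: yd; rewrite lt_min => /andP[].
  by move: zd; rewrite lt_min => /andP[].
- move=> i; apply: on_axis.
  rewrite normrM (gtr0_norm m0) -mulrA mulrCA ltr_pM2l //.
  exact: le_lt_trans (norm_coord_le h _) hr.
move=> _ /le_trans; apply.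
rewrite -/m ler_pdivrMl //.
have := @ler_sum R _ (index_enum 'I_k.+1) xpredT _ _ (fun i _ => axis i).
under [X in _ -> X <= _]eq_bigr do rewrite inord_val.
move=> /le_trans; apply; rewrite !big_split /= sumr_const card_ord.
rewrite !mulrDr mulr_natl mulr_sumr.
under eq_bigr do rewrite -mulrA.
rewrite lerD2l -mulr_sumr.
have := enorm_sqr_le h; rewrite enorm_sqr -/m => hh.
under eq_bigr do rewrite exprMn.
rewrite -mulr_sumr.
have : 0 <= M * m ^+ 2 by rewrite mulr_ge0 // sqr_ge0.
by move=> Mm; rewrite [leLHS]mulrA [leRHS]mulrCA ler_wpM2l.
Qed.

(** Apply the quadratic upper bound at c = t x + (1 - t) y to the increments
    x - c and y - c: the linear terms cancel in the weighted sum. *)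
Lemma convex_C2_semiconcave (R : realType) (k : nat) (delta : R)
    (f : 'rV[R]_k.+1 -> R) :
  0 < delta -> Ck 2 (eball 0 delta) f ->
  (forall x y t, eball 0 delta x -> eball 0 delta y -> 0 <= t <= 1 ->
    f (t *: x + (1 - t) *: y) <= t * f x + (1 - t) * f y) ->
  exists r C, [/\ 0 < r, 0 <= C & forall x y t,
    `|x| < r -> `|y| < r -> 0 <= t <= 1 ->
    t * f x + (1 - t) * f y
      <= f (t *: x + (1 - t) *: y) + C * (t * (1 - t) * `|x - y| ^+ 2)].
Proof.
move=> delta0 fC2 fconv.
have [r [C [r0 C0 ub]]] := convex_C2_quadratic_ub delta0 fC2 fconv.
exists r, C; split=> // x y t xr yr /andP[t0 t1].
have t1' : 0 <= 1 - t by lra.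
set c := t *: x + (1 - t) *: y.
have cr : `|c| < r.
  by apply: norm_conv_lt => //; rewrite t0.
have [p cp] := ub c cr.
have vr : `|x - y| < 2 * r by apply: (le_lt_trans (ler_normB _ _)); lra.
have small s : 0 <= s <= 1 -> `|s *: (x - y)| < 2 * r.
  move=> /andP[s0 s1]; rewrite normrZ ger0_norm //.
  by apply: le_lt_trans vr; rewrite ler_piMl.
have xE : x = c + (1 - t) *: (x - y).
  by apply/rowP => i; rewrite !mxE; ring.
have yE : y = c + - (t *: (x - y)).
  by apply/rowP => i; rewrite !mxE; ring.
pose S := \sum_i (x - y) 0 i * p i.
have fx : f x <= f c + (1 - t) * S + C * ((1 - t) * `|x - y|) ^+ 2.
  rewrite {1}xE; apply: le_trans (cp _ (small (1 - t) _)) _; first lra.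
  rewrite normrZ (ger0_norm t1') lerD2r lerD2l /S mulr_sumr.
  by apply: ler_sum => i _; rewrite !mxE mulrA.
have fy : f y <= f c - t * S + C * (t * `|x - y|) ^+ 2.
  rewrite {1}yE; apply: le_trans (cp (- _) _) _.
    by rewrite normrN; apply: small; rewrite t0.
  rewrite normrN normrZ (ger0_norm t0) lerD2r lerD2l /S mulr_sumr -sumrN.
  by apply: ler_sum => i _; rewrite !mxE !mulNr mulrA.
have := ler_wpM2l t0 fx; have := ler_wpM2l t1' fy; lra.
Qed.

(** * Local coordinates *)

(** The rows of E and e form an orthogonal matrix, whose transpose is also a left
    inverse: every point has coordinates.  Placing e first gives this matrix the
    dimension 1 + k.+1, which is k.+2 by computation. *)
Lemma orthonormal_axesV (R : realType) (k : nat) (E : 'M[R]_(k.+1, k.+2))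
    (e : 'rV[R]_k.+2) :
  E *m E^T = 1%:M -> E *m e^T = 0 -> e *m e^T = 1%:M ->
  E^T *m E + e^T *m e = 1%:M.
Proof.
move=> EE Ee ee.
have : col_mx e E *m (col_mx e E)^T = 1%:M.
  rewrite tr_col_mx mul_col_row ee EE Ee.
  have -> : e *m E^T = 0 by rewrite -[e]trmxK -trmx_mul Ee trmx0.
  by rewrite -scalar_mx_block.
move=> /mulmx1C <-.
by rewrite tr_col_mx mul_row_col addrC.
Qed.

Lemma from_coord_conv (R : realType) (n : nat) (xi : 'rV[R]_n) E e x y a b t :
  from_coord xi E e (t *: x + (1 - t) *: y) (t * a + (1 - t) * b)
    = t *: from_coord xi E e x a + (1 - t) *: from_coord xi E e y b.
Proof.
rewrite /from_coord mulmxDl -!scalemxAl.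
by apply/rowP => i; rewrite !mxE; ring.
Qed.

Lemma from_coordB (R : realType) (n : nat) (xi : 'rV[R]_n) E e x a s :
  from_coord xi E e x a - s *: e = from_coord xi E e x (a - s).
Proof. by rewrite /from_coord; apply/rowP => i; rewrite !mxE; ring. Qed.

Lemma from_coord_dist (R : realType) (n : nat) (xi : 'rV[R]_n)
    (E : 'M[R]_(n.-1, n)) (e : 'rV[R]_n) :
  exists2 B, 0 <= B & forall x y a b,
    `|from_coord xi E e x a - from_coord xi E e y b|
      <= B * `|x - y| + `|a - b| * `|e|.
Proof.
have [B B0 EB] := mulmx_bounded E; exists B => // x y a b.
have -> : from_coord xi E e x a - from_coord xi E e y b
    = (x - y) *m E + (a - b) *: e.
  by rewrite /from_coord mulmxBl; apply/rowP => i; rewrite !mxE; ring.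
by apply: le_trans (ler_normD _ _) _; rewrite normrZ lerD2r.
Qed.

(** * The boundary of a convex set as a graph *)

(** Points slightly above the graph are in Omega, hence so are those slightly
    above a chord. *)
Lemma graph_convex (R : realType) (n : nat) (Omega : set 'rV[R]_n)
    (xi : 'rV[R]_n) E e delta rho :
  convex_set Omega -> local_graph Omega xi E e delta rho ->
  forall x y t, eball 0 delta x -> eball 0 delta y -> 0 <= t <= 1 ->
    rho (t *: x + (1 - t) *: y) <= t * rho x + (1 - t) * rho y.
Proof.
move=> Oconv [_ _ _ [h h0 graph]] x y t xd yd t01.
have [t0 t1] := andP t01; have t1' : 0 <= 1 - t by lra.
have cd := eball0_conv xd yd t01.
have [rx Gx] := graph _ xd; have [ry Gy] := graph _ yd.
have [rc Gc] := graph _ cd.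
pose m := Num.max `|rho x| `|rho y|.
have mh : m < h by rewrite gt_max rx.
have xm : `|rho x| <= m by rewrite le_max lexx.
have ym : `|rho y| <= m by rewrite le_max lexx orbT.
apply/ler_addgt0Pr => s s0.
(* the second term keeps the shifted points in the cylinder |s| < h *)
pose q := Num.min s ((h - m) / 2).
have q0 : 0 < q by rewrite lt_min s0 divr_gt0 // subr_gt0.
have qs : q <= s by rewrite ge_min lexx.
have qm : q <= (h - m) / 2 by rewrite ge_min lexx orbT.
have bd a : `|a| <= m -> `|a + q| < h.
  by rewrite ler_norml ltr_norml; clear - q0 qm mh; lra.
have Ox : Omega (from_coord xi E e x (rho x + q)).
  by apply/(Gx _ (bd _ xm)).2; lra.
have Oy : Omega (from_coord xi E e y (rho y + q)).
  by apply/(Gy _ (bd _ ym)).2; lra.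
have := convex_setP Oconv Ox Oy t01; rewrite -from_coord_conv.
have -> : t * (rho x + q) + (1 - t) * (rho y + q)
    = t * rho x + (1 - t) * rho y + q by ring.
have sm := normr_conv_le xm ym t01.
by move=> /(Gc _ (bd _ sm)).2; lra.
Qed.

Lemma graph_lipschitz (R : realType) (n : nat) (Omega : set 'rV[R]_n)
    (xi : 'rV[R]_n) E e delta rho :
  convex_set Omega -> local_graph Omega xi E e delta rho ->
  exists r L, [/\ 0 < r, 0 <= L,
    forall x : 'rV[R]_n.-1, `|x| < r -> eball 0 delta x &
    forall x y : 'rV[R]_n.-1, `|x| < r -> `|y| < r -> `|rho x - rho y| <= L * `|x - y|].
Proof.
move=> Oconv lg; have rconv := graph_convex Oconv lg.
have [_ delta0 _ [h h0 graph]] := lg.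
have [d d0 dP] := enorm_lt n.-1 delta0.
have in_ball (x : 'rV[R]_n.-1) : `|x| < d -> eball 0 delta x.
  by move=> xd; rewrite /eball /= subr0; exact: dP.
exists (d / 2), (4 * h / d); split.
- by rewrite divr_gt0.
- by rewrite divr_ge0 ?mulr_ge0 // ltW.
- by move=> x xd; apply: in_ball; lra.
- apply: convex_bounded_lipschitz => //; first exact: ltW.
    by move=> x y t xd yd; apply: rconv; exact: in_ball.
  by move=> x /in_ball /graph [/ltW].
Qed.

Lemma below_graph_exterior (R : realType) (n : nat) (Omega : set 'rV[R]_n)
    (xi : 'rV[R]_n) E e delta rho :
  local_graph Omega xi E e delta rho ->
  exists2 h, 0 < h & forall x s, eball 0 delta x -> `|s| < h ->
    (s < rho x -> (~` closure Omega) (from_coord xi E e x s)) /\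
    (s <= rho x -> (~` Omega) (from_coord xi E e x s)).
Proof.
move=> [_ _ _ [h h0 graph]]; exists h => // x s xd sh.
have [_ /(_ s sh) [bdP omP]] := graph x xd; split=> sx.
  move=> cl; have [inO|notinO] := pselect (Omega (from_coord xi E e x s)).
    by move/omP: inO; lra.
  have : boundary Omega (from_coord xi E e x s).
    by split=> // /interior_subset.
  by move/bdP; lra.
by move/omP; lra.
Qed.

(** G is the height over the graph in the coordinates where the boundary is C^2,
    as a function of the point of space.  Stated without these coordinates, its
    properties can be used in any others. *)
Lemma C2_convex_defining_function (R : realType) (k : nat)
    (Omega : set 'rV[R]_k.+2) (xi : 'rV[R]_k.+2) (E : 'M[R]_(k.+1, k.+2))
    (e : 'rV[R]_k.+2) (delta : R) (rho : 'rV[R]_k.+1 -> R) :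
  convex_set Omega -> local_graph Omega xi E e delta rho ->
  Ck 2 (eball 0 delta) rho ->
  exists (G : 'rV[R]_k.+2 -> R) (eta C L : R), [/\ 0 < eta, 0 <= C, 0 <= L &
    [/\ forall p, `|p - xi| < eta ->
          (Omega p <-> 0 < G p) /\ (boundary Omega p <-> G p = 0),
        forall p q t, `|p - xi| < eta -> `|q - xi| < eta -> 0 <= t <= 1 ->
          t * G p + (1 - t) * G q <= G (t *: p + (1 - t) *: q)
          <= t * G p + (1 - t) * G q + C * (t * (1 - t) * `|p - q| ^+ 2) &
        forall p q, `|p - xi| < eta -> `|q - xi| < eta ->
          `|G p - G q| <= L * `|p - q|]].
Proof.
move=> Oconv lg rhoC2.
have rconv := graph_convex Oconv lg.
have [r1 [L1 [r10 L10 in_ball lip]]] := graph_lipschitz Oconv lg.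
have [[EE Ee ee] delta0 rho0 [h h0 graph]] := lg.
have [r2 [C [r20 C0 sc]]] := convex_C2_semiconcave delta0 rhoC2 rconv.
have [B B0 EB] := mulmx_bounded E^T.
have [b b0 eb] := mulmx_bounded e^T.
pose y' (p : 'rV[R]_k.+2) := (p - xi) *m E^T.
pose yn (p : 'rV[R]_k.+2) : R := ((p - xi) *m e^T) 0 0.
have coordK p : from_coord xi E e (y' p) (yn p) = p.
  rewrite /from_coord -mul_scalar_mx -mx11_scalar /y' -!mulmxA -addrA -mulmxDr.
  by rewrite orthonormal_axesV // mulmx1 addrC subrK.
have y'B p q : `|y' p - y' q| <= B * `|p - q|.
  rewrite /y' -mulmxBl; apply: le_trans (EB _) _.
  by rewrite opprB addrA subrK.
have ynB p q : `|yn p - yn q| <= b * `|p - q|.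
  have -> : yn p - yn q = ((p - q) *m e^T) 0 0.
    have -> : p - q = (p - xi) - (q - xi) by rewrite opprB addrA subrK.
    by rewrite /yn [in RHS]mulmxBl [in RHS]mxE [X in _ = _ + X]mxE.
  by apply: le_trans (norm_coord_le _ _) _; exact: eb.
have y'xi : y' xi = 0 by rewrite /y' subrr mul0mx.
have ynxi : yn xi = 0 by rewrite /yn subrr mul0mx mxE.
pose r := Num.min r1 r2; have r0 : 0 < r by rewrite lt_min r10.
pose eta := Num.min (r / (1 + B)) (h / (1 + b)).
have B1 : 0 < 1 + B by rewrite ltr_pwDl.
have b1 : 0 < 1 + b by rewrite ltr_pwDl.
have eta0 : 0 < eta by rewrite lt_min !divr_gt0.
have y'r p : `|p - xi| < eta -> `|y' p| < r.
  rewrite lt_min ltr_pdivlMr // => /andP[pr _].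
  have := y'B p xi; rewrite y'xi subr0 => /le_lt_trans; apply.
  by move: pr (normr_ge0 (p - xi)); clear; lra.
have ynh p : `|p - xi| < eta -> `|yn p| < h.
  rewrite lt_min [X in _ && X]ltr_pdivlMr // => /andP[_ ph].
  have := ynB p xi; rewrite ynxi subr0 => /le_lt_trans; apply.
  by move: ph (normr_ge0 (p - xi)); clear; lra.
have r_r1 x : x < r -> x < r1 by rewrite lt_min => /andP[].
have r_r2 x : x < r -> x < r2 by rewrite lt_min => /andP[].
exists (fun p => yn p - rho (y' p)), eta, (C * B ^+ 2), (b + L1 * B).
split=> //; first by rewrite mulr_ge0 // sqr_ge0.
  by rewrite addr_ge0 // mulr_ge0.
split.
- move=> p pe; have [_] := graph _ (in_ball _ (r_r1 _ (y'r p pe))).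
  move=> /(_ _ (ynh p pe)); rewrite coordK => -[bd om]; split.
    by apply: (iff_trans om); rewrite subr_gt0.
  by apply: (iff_trans bd); split => [->|/eqP]; rewrite ?subrr // subr_eq0 => /eqP.
- move=> p q t pe qe t01; have [t0 t1] := andP t01.
  have t1' : 0 <= 1 - t by rewrite subr_ge0.
  have y'c : y' (t *: p + (1 - t) *: q) = t *: y' p + (1 - t) *: y' q.
    rewrite /y' !scalemxAl -mulmxDl; congr (_ *m _).
    by apply/rowP => i; rewrite !mxE; ring.
  have ync : yn (t *: p + (1 - t) *: q) = t * yn p + (1 - t) * yn q.
    have -> : yn (t *: p + (1 - t) *: q)
        = (t *: ((p - xi) *m e^T) + (1 - t) *: ((q - xi) *m e^T)) 0 0.
      rewrite !scalemxAl -mulmxDl; congr ((_ *m _) 0 0).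
      by apply/rowP => i; rewrite !mxE; ring.
    by rewrite mxE [X in X + _]mxE [X in _ + X]mxE.
  have pr := y'r p pe; have qr := y'r q qe.
  have lo := rconv _ _ t (in_ball _ (r_r1 _ pr)) (in_ball _ (r_r1 _ qr)) t01.
  have up := sc _ _ t (r_r2 _ pr) (r_r2 _ qr) t01.
  rewrite y'c ync; apply/andP; split; first by move: lo; clear; lra.
  have tt : 0 <= t * (1 - t) by rewrite mulr_ge0.
  have y'2 : `|y' p - y' q| ^+ 2 <= (B * `|p - q|) ^+ 2.
    by rewrite lerXn2r ?nnegrE ?y'B // mulr_ge0.
  by have := ler_wpM2l (mulr_ge0 C0 tt) y'2; move: up; clear; lra.
- move=> p q pe qe.
  have := lip _ _ (r_r1 _ (y'r p pe)) (r_r1 _ (y'r q qe)).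
  have := ler_wpM2l L10 (y'B p q); have := ynB p q.
  by rewrite !ler_norml; clear; lra.
Qed.

(** The axes E, e are arbitrary, so the bound is read off the defining function G
    of the smooth coordinates.  The point xi + s0 e of Omega, where G = a > 0,
    gives G >= a / 2 at height s0 above all boundary points P c near xi.  As G vanishes at P c, concavity gives
    G(P c + s e) >= s a / (2 s0).  If s is the height of a chord above P c, the
    left-hand side is at most quadratic in the length of the chord. *)
Lemma graph_semiconcave (R : realType) (k : nat)
    (Omega : set 'rV[R]_k.+2) (xi : 'rV[R]_k.+2) (E : 'M[R]_(k.+1, k.+2))
    (e : 'rV[R]_k.+2) (delta : R) (rho : 'rV[R]_k.+1 -> R) :
  convex_set Omega -> Ck_boundary 2 Omega -> boundary Omega xi ->
  local_graph Omega xi E e delta rho ->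
  exists r C, [/\ 0 < r, 0 <= C & forall x y t,
    `|x| < r -> `|y| < r -> 0 <= t <= 1 ->
    t * rho x + (1 - t) * rho y
      <= rho (t *: x + (1 - t) *: y) + C * (t * (1 - t) * `|x - y| ^+ 2)].
Proof.
move=> Oconv OC2 xibd lg.
have [E0 [e0 [delta' [rho' [lg' rho'C2]]]]] := OC2 _ xibd.
have [G [eta [C [L [eta0 C0 L0 [Gsign Gconc Glip]]]]]] :=
  C2_convex_defining_function Oconv lg' rho'C2.
have rconv := graph_convex Oconv lg.
have [r1 [Lr [r10 Lr0 in_ball lip]]] := graph_lipschitz Oconv lg.
have [_ delta0 rho0 [h h0 graph]] := lg.
have [B B0 XB] := from_coord_dist xi E e.
pose P x := from_coord xi E e x (rho x).
pose N := B + Lr * `|e|.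
have N0 : 0 <= N by rewrite addr_ge0 // mulr_ge0.
have PB x y : `|x| < r1 -> `|y| < r1 -> `|P x - P y| <= N * `|x - y|.
  move=> xr yr; apply: le_trans (XB _ _ _ _) _.
  by rewrite /N mulrDl lerD2l mulrAC ler_wpM2r // lip.
have P0 : P 0 = xi by rewrite /P /from_coord rho0 mul0mx scale0r !addr0.
have Pxi x : `|x| < r1 -> `|P x - xi| <= N * `|x|.
  by move=> xr; rewrite -P0 -{2}[x]subr0; apply: PB; rewrite ?normr0.
have e1 : 0 < 1 + `|e| by rewrite ltr_pwDl.
pose s0 := Num.min (h / 2) (eta / 2 / (1 + `|e|)).
have s00 : 0 < s0 by rewrite lt_min !divr_gt0.
have s0h : s0 < h by rewrite gt_min; apply/orP; left; lra.
have s0e : s0 * `|e| < eta / 2.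
  have : s0 <= eta / 2 / (1 + `|e|) by rewrite ge_min lexx orbT.
  by rewrite ler_pdivlMr // mulrDr mulr1; lra.
have xiA : xi + s0 *: e = from_coord xi E e 0 s0.
  by rewrite /from_coord mul0mx addr0.
have nA : `|xi + s0 *: e - xi| < eta.
  by rewrite addrAC subrr add0r normrZ gtr0_norm //; clear - s0e eta0; lra.
pose a := G (xi + s0 *: e).
have a0 : 0 < a.
  apply/(Gsign _ nA).1; rewrite xiA.
  have z0 : eball 0 delta (0 : 'rV[R]_k.+1) by apply: in_ball; rewrite normr0.
  by apply/((graph 0 z0).2 s0 _).2; rewrite ?rho0 // gtr0_norm.
pose r := Num.min r1 (Num.min (eta / 2 / (1 + N))
  (Num.min (a / 2 / (1 + L * N)) (s0 / (1 + 3 * Lr)))).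
have N1 : 0 < 1 + N by rewrite ltr_pwDl.
have LN0 : 0 <= L * N by rewrite mulr_ge0.
have LN1 : 0 < 1 + L * N by rewrite ltr_pwDl.
have Lr1 : 0 < 1 + 3 * Lr by rewrite ltr_pwDl // mulr_ge0.
have r0 : 0 < r by rewrite !lt_min r10 !divr_gt0.
have rP (x : 'rV[R]_k.+1) : `|x| < r ->
    [/\ `|x| < r1, N * `|x| < eta / 2, L * (N * `|x|) <= a / 2
      & 3 * (Lr * `|x|) <= s0].
  rewrite !lt_min !ltr_pdivlMr // => /and4P[x1 x2 x3 x4].
  by move: (normr_ge0 x); clear - x1 x2 x3 x4; split => //; lra.
exists r, (2 * s0 / a * (C * N ^+ 2)); split=> //.
  by rewrite !mulr_ge0 // ?sqr_ge0 // ?invr_ge0 ltW.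
move=> x y t xr yr t01; have [t0 t1] := andP t01; have t1' : 0 <= 1 - t by rewrite subr_ge0.
have := norm_conv_lt xr yr t01; set c := t *: x + (1 - t) *: y => cr.
have [x1 x2 x3 x4] := rP _ xr; have [y1 y2 y3 y4] := rP _ yr.
have [c1 c2 c3 c4] := rP _ cr.
have Px := Pxi _ x1; have Py := Pxi _ y1; have Pc := Pxi _ c1.
have onbd z : `|z| < r1 -> `|P z - xi| < eta -> G (P z) = 0.
  move=> zr /Gsign[_ Gb]; apply/Gb.
  have [zh /(_ _ zh)[bd _]] := graph _ (in_ball _ zr).
  exact/bd.
pose s := t * rho x + (1 - t) * rho y - rho c.
have s_ge0 : 0 <= s.
  by rewrite subr_ge0; apply: rconv => //; exact: in_ball.
have rho_le z : `|z| < r1 -> `|rho z| <= Lr * `|z|.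
  move=> zr; have := lip z 0 zr; rewrite rho0 !subr0 normr0; exact.
have s_le : s <= s0.
  have third z : `|z| < r1 -> 3 * (Lr * `|z|) <= s0 -> `|rho z| <= s0 / 3.
    by move=> /rho_le; clear; lra.
  have := normr_conv_le (third _ x1 x4) (third _ y1 y4) t01.
  by have := third _ c1 c4; rewrite /s !ler_norml; clear - s00; lra.
have QE : t *: P x + (1 - t) *: P y = P c + s *: e.
  rewrite /P -from_coord_conv -[X in _ + X *: e]opprK scaleNr from_coordB.
  by congr from_coord; rewrite /s; ring.
have half_eta z : z < eta / 2 -> z < eta by clear - eta0; lra.
have Pce : `|P c - xi| < eta by apply: half_eta; exact: le_lt_trans c2.
have Pxe : `|P x - xi| < eta by apply: half_eta; exact: le_lt_trans x2.
have Pye : `|P y - xi| < eta by apply: half_eta; exact: le_lt_trans y2.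
have [_ up] := andP (Gconc _ _ _ Pxe Pye t01).
rewrite QE (onbd _ x1 Pxe) (onbd _ y1 Pye) in up.
have nc0 : `|P c + s0 *: e - xi| < eta.
  have -> : P c + s0 *: e - xi = (P c - xi) + s0 *: e by rewrite addrAC.
  apply: (le_lt_trans (ler_normD _ _)); rewrite normrZ (gtr0_norm s00).
  by clear - Pc c2 s0e; lra.
have Gc0 : a / 2 <= G (P c + s0 *: e).
  have := Glip _ _ nc0 nA; rewrite -/a.
  have -> : P c + s0 *: e - (xi + s0 *: e) = P c - xi.
    by rewrite opprD addrACA subrr addr0.
  by have := ler_wpM2l L0 Pc; rewrite ler_norml; clear - c3; lra.
have ss0 : 0 <= s / s0 <= 1.
  by rewrite divr_ge0 ?(ltW s00) //= ler_pdivrMr // mul1r.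
have [lo _] := andP (Gconc _ _ _ nc0 Pce ss0).
have QE' : s / s0 *: (P c + s0 *: e) + (1 - s / s0) *: P c = P c + s *: e.
  by apply/rowP => i; rewrite !mxE; field; rewrite gt_eqF.
rewrite QE' (onbd _ c1 Pce) in lo.
have lo' := ler_wpM2l (andP ss0).1 Gc0.
have PB2 : `|P x - P y| ^+ 2 <= (N * `|x - y|) ^+ 2.
  by rewrite lerXn2r ?nnegrE ?PB // mulr_ge0.
have tt : 0 <= t * (1 - t) by rewrite mulr_ge0.
have PB3 := ler_wpM2l (mulr_ge0 C0 tt) PB2.
have : s / s0 * (a / 2) <= C * N ^+ 2 * (t * (1 - t) * `|x - y| ^+ 2).
  by clear - lo' lo up PB3; lra.
have -> : s / s0 * (a / 2) = s / (2 * s0 / a).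
  by field; rewrite !gt_eqF.
rewrite ler_pdivrMr ?divr_gt0 ?mulr_gt0 // /s mulrC mulrA.
by clear; lra.
Qed.

(** * Boundary values of exterior locally convex functions *)

(** Shifting the segment down by less than h - max(|a|, |b|) keeps it in the
    cylinder of the local coordinates and moves it off the graph. *)
Lemma exterior_convex_below_graph (R : realType) (n : nat)
    (Omega : set 'rV[R]_n) (u : 'rV[R]_n -> R) (xi : 'rV[R]_n)
    (E : 'M[R]_(n.-1, n)) (e : 'rV[R]_n) (delta : R)
    (rho : 'rV[R]_n.-1 -> R) :
  {within ~` Omega, continuous u} -> {in ~` closure Omega, continuous u} ->
  Defs.locally_convex (~` closure Omega) u ->
  local_graph Omega xi E e delta rho ->
  exists2 h, 0 < h & forall x y a b,
    eball 0 delta x -> eball 0 delta y -> `|a| < h -> `|b| < h ->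
    (forall t, 0 <= t <= 1 ->
       t * a + (1 - t) * b <= rho (t *: x + (1 - t) *: y)) ->
    forall t, 0 <= t <= 1 ->
      u (from_coord xi E e (t *: x + (1 - t) *: y) (t * a + (1 - t) * b))
        <= t * u (from_coord xi E e x a) + (1 - t) * u (from_coord xi E e y b).
Proof.
move=> uA uD uconv /below_graph_exterior[h h0 ext]; exists h => //.
move=> x y a b xd yd ah bh ab t t01; rewrite from_coord_conv.
have DA : ~` closure Omega `<=` ~` Omega.
  by move=> p pD pO; apply: pD; exact: subset_closure.
pose m := Num.max `|a| `|b|.
have mh : 0 < h - m by rewrite subr_gt0 gt_max ah.
have am : `|a| <= m by rewrite le_max lexx.
have bm : `|b| <= m by rewrite le_max lexx orbT.
apply: (convex_segment_limit (v := e) uA uD uconv DA mh) => //.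
- move=> s s01; rewrite -from_coord_conv.
  apply: (ext _ _ (eball0_conv xd yd s01) _).2; last exact: ab.
  by apply: le_lt_trans (normr_conv_le am bm s01) _; rewrite -subr_gt0.
- move=> s q s01 /andP[q0 qm]; rewrite -from_coord_conv from_coordB.
  apply: (ext _ _ (eball0_conv xd yd s01) _).1.
    apply: le_lt_trans (ler_normB _ _) _; rewrite (gtr0_norm q0) -ltrBrDr.
    apply: le_lt_trans (normr_conv_le am bm s01) _.
    by rewrite ltrBrDr addrC -ltrBrDr.
  by apply: lt_le_trans (ab _ s01); rewrite gtrBl.
Qed.

(** By convexity along the vertical segment of length s under the graph, the
    increase of u is at most the fraction (rho x - l) / s of its increase at the
    lower end, which is bounded near xi by continuity of u at xi and at the point
    at depth s under xi. *)
Lemma exterior_downward_growth (R : realType) (n : nat)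
    (Omega : set 'rV[R]_n) (u : 'rV[R]_n -> R) (xi : 'rV[R]_n)
    (E : 'M[R]_(n.-1, n)) (e : 'rV[R]_n) (delta : R)
    (rho : 'rV[R]_n.-1 -> R) :
  convex_set Omega ->
  {within ~` Omega, continuous u} -> {in ~` closure Omega, continuous u} ->
  Defs.locally_convex (~` closure Omega) u ->
  local_graph Omega xi E e delta rho ->
  exists r s M, [/\ 0 < r, 0 < s, 0 <= M & forall x l,
    `|x| < r -> rho x - s <= l <= rho x ->
    u (from_coord xi E e x l)
      <= u (from_coord xi E e x (rho x)) + M * (rho x - l)].
Proof.
move=> Oconv uA uD uconv lg.
have [r1 [L [r10 L0 in_ball lip]]] := graph_lipschitz Oconv lg.
have [_ _ rho0 _] := lg.
have [h1 h10 ext] := below_graph_exterior lg.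
have [h2 h20 below] := exterior_convex_below_graph uA uD uconv lg.
have [B B0 XB] := from_coord_dist xi E e.
set X := from_coord xi E e; pose N := B + L * `|e|.
have N0 : 0 <= N by rewrite addr_ge0 // mulr_ge0.
have [s [s0 sh1 sh2]] : exists s, [/\ 0 < s, 2 * s <= h1 & 2 * s <= h2].
  exists (Num.min h1 h2 / 2); rewrite [2 * _]mulrC divfK //.
  by rewrite divr_gt0 ?lt_min ?h10 // !ge_min !lexx orbT.
have zero_r1 : `|0 : 'rV[R]_n.-1| < r1 by rewrite normr0.
have z_ball := in_ball _ zero_r1.
have Axi : (~` Omega) (X 0 0).
  by apply: (ext _ _ z_ball _).2; rewrite ?normr0 ?rho0.
have Abot : (~` Omega) (X 0 (- s)).
  apply: (ext _ _ z_ball _).2; last by rewrite rho0 oppr_le0 ltW.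
  by rewrite normrN gtr0_norm //; clear - s0 sh1; lra.
have uA' := within_continuous_dist uA.
have [d1 d10 ud1] := uA' _ _ Axi ltr01.
have [d2 d20 ud2] := uA' _ _ Abot ltr01.
have L1 : 0 < 1 + L by rewrite ltr_pwDl.
have N1 : 0 < 1 + N by rewrite ltr_pwDl.
pose r := Num.min r1 (Num.min (s / (1 + L))
  (Num.min (d1 / (1 + N)) (d2 / (1 + N)))).
have r0 : 0 < r by rewrite !lt_min r10 !divr_gt0.
(* u varies by less than 1 near each of the two ends of the segment over 0 *)
pose bd := `|u (X 0 (- s)) - u (X 0 0)| + 2.
have bd0 : 0 <= bd by rewrite addr_ge0.
exists r, s, (bd / s); split=> // [|x l xr /andP[l1 l2]].
  by rewrite divr_ge0 // ltW.
have [x1 x2 x3 x4] : [/\ `|x| < r1, L * `|x| < s, N * `|x| < d1 & N * `|x| < d2].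
  move: xr; rewrite !lt_min !ltr_pdivlMr // => /and4P[x1 x2 x3 x4].
  by have := normr_ge0 x; clear - x1 x2 x3 x4; split => //; lra.
have rhoL : `|rho x| <= L * `|x|.
  by have := lip x 0 x1 zero_r1; rewrite rho0 !subr0.
have rhos : `|rho x| < s := le_lt_trans rhoL x2.
have rhobs : `|rho x - s| < 2 * s.
  by move: rhos; rewrite !ltr_norml; clear - s0; lra.
have rhoh : `|rho x| < 2 * s by clear - s0 rhos; lra.
pose th := (rho x - l) / s.
have th01 : 0 <= th <= 1.
  apply/andP; split; first by rewrite divr_ge0 ?subr_ge0 // ltW.
  by rewrite ler_pdivrMr // mul1r lerBlDr addrC -lerBlDr.
have th01' : 0 <= 1 - th <= 1 by clear - th01; lra.
have convxx t : t *: x + (1 - t) *: x = x.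
  by rewrite -scalerDl addrC subrK scale1r.
have := below x x (rho x) (rho x - s) (in_ball _ x1) (in_ball _ x1)
  (lt_le_trans rhoh sh2) (lt_le_trans rhobs sh2) _ _ th01'.
rewrite convxx.
have -> : (1 - th) * rho x + (1 - (1 - th)) * (rho x - s) = l.
  by rewrite /th; field; rewrite gt_eqF.
move=> /(_ _)/le_trans; apply.
  by move=> t /andP[_ t1]; rewrite convxx; clear - s0 t1; nra.
rewrite -/X.
have XN a b : `|a - b| <= `|rho x| -> `|X x a - X 0 b| <= N * `|x|.
  move=> abr; have := XB x 0 a b; rewrite subr0 => /le_trans; apply.
  rewrite /N mulrDl lerD2l mulrAC ler_wpM2r //.
  exact: le_trans abr rhoL.
have top : `|u (X x (rho x)) - u (X 0 0)| < 1.
  apply: ud1; last by apply: le_lt_trans (XN _ _ _) x3; rewrite subr0.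
  by apply: (ext _ _ (in_ball _ x1) _).2 => //; exact: lt_le_trans sh1.
have bot : `|u (X x (rho x - s)) - u (X 0 (- s))| < 1.
  apply: ud2; last by apply: le_lt_trans (XN _ _ _) x4; rewrite opprK subrK.
  apply: (ext _ _ (in_ball _ x1) _).2; first exact: lt_le_trans sh1.
  by rewrite gerBl ltW.
have gap : u (X x (rho x - s)) - u (X x (rho x)) <= bd.
  rewrite /bd; move: top bot (ler_norm (u (X 0 (- s)) - u (X 0 0))).
  by rewrite !ltr_norml; clear; lra.
have -> : bd / s * (rho x - l) = th * bd by rewrite /th mulrC mulrA mulrAC.
by have := ler_wpM2l (andP th01).1 gap; clear; lra.
Qed.

(** In other words, psi + M rho is convex near the origin.  The lifted segment
    runs from X(x,a) to X(y,b), where a and b are the values at x and y of an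
    affine function supporting rho at c = t x + (1 - t) y. *)
Lemma exterior_trace_convexity_defect (R : realType) (n : nat)
    (Omega : set 'rV[R]_n) (u : 'rV[R]_n -> R) (xi : 'rV[R]_n)
    (E : 'M[R]_(n.-1, n)) (e : 'rV[R]_n) (delta : R)
    (rho : 'rV[R]_n.-1 -> R) (psi := fun x => u (from_coord xi E e x (rho x))) :
  convex_set Omega ->
  {within ~` Omega, continuous u} -> {in ~` closure Omega, continuous u} ->
  Defs.locally_convex (~` closure Omega) u ->
  local_graph Omega xi E e delta rho ->
  exists r M, [/\ 0 < r, 0 <= M & forall x y t,
    `|x| < r -> `|y| < r -> 0 <= t <= 1 ->
    psi (t *: x + (1 - t) *: y) <= t * psi x + (1 - t) * psi y
      + M * (t * rho x + (1 - t) * rho y - rho (t *: x + (1 - t) *: y))].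
Proof.
move=> Oconv uA uD uconv lg.
have [r1 [L [r10 L0 in_ball lip]]] := graph_lipschitz Oconv lg.
have [r2 [s [M [r20 s0 M0 down]]]] := exterior_downward_growth Oconv uA uD uconv lg.
have [h h0 below] := exterior_convex_below_graph uA uD uconv lg.
have rho0 : rho 0 = 0 by case: lg.
set X := from_coord xi E e in psi down below *.
have L1 : 0 < 1 + L by rewrite ltr_pwDl.
pose r := Num.min r1 (Num.min r2
  (Num.min (s / 4 / (1 + L)) (h / 4 / (1 + L)))).
have r0 : 0 < r by rewrite !lt_min r10 r20 !divr_gt0.
have rP (x : 'rV[R]_n.-1) : `|x| < r ->
    [/\ `|x| < r1, `|x| < r2, 4 * (L * `|x|) <= s & 4 * (L * `|x|) <= h].
  rewrite !lt_min !ltr_pdivlMr // => /and4P[x1 x2 x3 x4].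
  by have := normr_ge0 x; clear - x1 x2 x3 x4; split => //; lra.
exists r, M; split=> // x y t xr yr t01.
(* a supporting line needs points on both sides of c *)
have [t00|t0'] := eqVneq t 0.
  by rewrite t00 subr0 !scale0r !scale1r !add0r; clear; lra.
have [t10|t1'] := eqVneq t 1.
  by rewrite t10 subrr !scale0r !scale1r !addr0; clear; lra.
have t01' : 0 < t < 1.
  by rewrite !lt_neqAle eq_sym t0' t1'.
have [t0 t1] := andP t01'; have t1c : 0 < 1 - t by rewrite subr_gt0.
set c := t *: x + (1 - t) *: y.
have cr : `|c| < r by exact: norm_conv_lt.
have [x1 x2 xs xh] := rP _ xr; have [y1 y2 ys yh] := rP _ yr.
have [c1 _ cs ch] := rP _ cr.
have rconv (z w : 'rV[R]_n.-1) q : `|z| < r1 -> `|w| < r1 -> 0 <= q <= 1 ->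
    rho (q *: z + (1 - q) *: w) <= q * rho z + (1 - q) * rho w.
  by move=> /in_ball zb /in_ball wb; exact: graph_convex lg _ _ _ zb wb.
have [sigma supp] := convex_line_support rconv x1 y1 t01'.
have sx : rho c + sigma * (1 - t) <= rho x.
  by have := supp 1; rewrite subrr scale0r scale1r addr0 ler01 lexx; exact.
have sy : rho c + sigma * (0 - t) <= rho y.
  by have := supp 0; rewrite subr0 scale0r scale1r [0 + y]add0r ler01 lexx; exact.
have xy : L * `|x - y| <= L * `|x| + L * `|y|.
  by rewrite -mulrDr ler_wpM2l // ler_normB.
have sig_le : sigma <= L * `|x - y|.
  rewrite -(ler_pM2l t1c); have := lip _ _ x1 c1; rewrite ler_norml.
  have -> : x - c = (1 - t) *: (x - y).
    by rewrite /c; apply/rowP => i; rewrite !mxE; ring.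
  by rewrite normrZ gtr0_norm //; clear - sx; lra.
have sig_ge : - (L * `|x - y|) <= sigma.
  rewrite -(ler_pM2l t0); have := lip _ _ y1 c1; rewrite ler_norml.
  have -> : y - c = t *: (y - x).
    by rewrite /c; apply/rowP => i; rewrite !mxE; ring.
  by rewrite normrZ gtr0_norm // distrC; clear - sy; lra.
have rhoL (z : 'rV[R]_n.-1) : `|z| < r1 -> `|rho z| <= L * `|z|.
  move=> zr; have := lip z 0 zr; rewrite rho0 !subr0 normr0; exact.
have Rx := rhoL _ x1; have Ry := rhoL _ y1; have Rc := rhoL _ c1.
pose a := rho c + sigma * (1 - t); pose b := rho c + sigma * (0 - t).
have abE q : q * a + (1 - q) * b = rho c + sigma * (q - t).
  by rewrite /a /b; ring.
have sigL : `|sigma| <= L * `|x - y| by rewrite ler_norml sig_ge.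
have ab_le q : `|q| <= 1 -> `|rho c + sigma * q| <= L * `|c| + (L * `|x| + L * `|y|).
  move=> q1; apply: le_trans (ler_normD _ _) _; apply: lerD => //.
  apply: le_trans xy; apply: le_trans sigL; rewrite normrM.
  by rewrite ler_piMr.
have la : `|a| <= L * `|c| + (L * `|x| + L * `|y|).
  by apply: ab_le; rewrite gtr0_norm // gerBl ltW.
have lb : `|b| <= L * `|c| + (L * `|x| + L * `|y|).
  by apply: ab_le; rewrite sub0r normrN gtr0_norm // ltW.
have abh : L * `|c| + (L * `|x| + L * `|y|) < h by clear - xh yh ch h0; lra.
have := below x y a b (in_ball _ x1) (in_ball _ y1) (le_lt_trans la abh)
  (le_lt_trans lb abh) _ t t01.
rewrite -/c abE subrr mulr0 addr0 => /(_ _)/le_trans; apply.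
  by move=> q q01; rewrite abE; exact: supp.
have ux : u (X x a) <= psi x + M * (rho x - a).
  apply: down => //; rewrite sx andbT.
  by move: la Rx; rewrite !ler_norml; clear - xs ys cs; lra.
have uy : u (X y b) <= psi y + M * (rho y - b).
  apply: down => //; rewrite sy andbT.
  by move: lb Ry; rewrite !ler_norml; clear - xs ys cs; lra.
have := ler_wpM2l (ltW t0) ux; have := ler_wpM2l (ltW t1c) uy.
by have := abE t; rewrite subrr mulr0 addr0 => <-; clear; lra.
Qed.

(** * Semi-convexity of the boundary values *)

Unset Implicit Arguments.

Theorem theorem1p3 (R : realType) (n : nat) (hn : (3 <= n)%N)
    (Omega : set 'rV[R]_n) (phi u : 'rV[R]_n -> R)
    (Omega_domain : domain Omega) (Omega_bounded : bounded_set Omega)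
    (Omega_convex : convex_set Omega) (Omega_C3 : Ck_boundary 3 Omega)
    (u_C0 : {within ~` Omega, continuous u})
    (u_sol : viscosity_solution (~` closure Omega) u)
    (u_bdry : forall x, boundary Omega x -> u x = phi x) :
  semiconvex_wrt_boundary Omega phi.
Proof.
case: n hn => [//|[//|k]] _ in Omega phi u Omega_domain Omega_bounded
  Omega_convex Omega_C3 u_C0 u_sol u_bdry *.
have [uD uconv _ _] := u_sol.
move=> xi xibd E e [delta [rho lg]].
have OC2 : Ck_boundary 2 Omega.
  move=> z /Omega_C3[E0 [e0 [d0 [rho0 [lg0 rho0C3]]]]].
  by exists E0, e0, d0, rho0; split=> //; exact: CkW.
have [r1 [M [r10 M0 defect]]] :=
  exterior_trace_convexity_defect Omega_convex u_C0 uD uconv lg.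
have [r2 [C [r20 C0 sc]]] := graph_semiconcave Omega_convex OC2 xibd lg.
have [axes delta0 rho0 [h h0 graph]] := lg.
pose d := Num.min delta (Num.min r1 r2).
have d0 : 0 < d by rewrite !lt_min delta0 r10.
have dP (x : 'rV[R]_k.+1) : eball 0 d x -> [/\ eball 0 delta x, `|x| < r1 & `|x| < r2].
  rewrite /eball /= subr0 !lt_min => /and3P[xd x1 x2].
  by split=> //; exact: le_lt_trans (norm_le_enorm x) _.
exists d, rho; split.
  by split=> //; exists h => // x /dP[xd _ _]; exact: graph.
have K0 : 0 < 2 * M * C + 1 by rewrite ltr_pwDr // !mulr_ge0.
(* half of 2 M C absorbs the defect M C of psi; adding 1 makes the constant
   positive even if M C = 0 *)
exists (2 * M * C + 1) => //; apply/convex_functionP => x y t xd yd t01.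
have [t0 t1] := andP t01; have t1' : 0 <= 1 - t by lra.
have phiE z : eball 0 d z ->
    phi (from_coord xi E e z (rho z)) = u (from_coord xi E e z (rho z)).
  move=> /dP[/graph[rh /(_ _ rh)[bd _]] _ _].
  by rewrite u_bdry //; exact/bd.
rewrite !phiE //; last exact: eball0_conv.
have [_ x1 x2] := dP _ xd; have [_ y1 y2] := dP _ yd.
have def := defect _ _ _ x1 y1 t01.
have {}sc := sc _ _ _ x2 y2 t01.
rewrite enorm_sqr_conv.
set c := t *: x + (1 - t) *: y in def sc *.
have scM : M * (t * rho x + (1 - t) * rho y - rho c)
    <= M * (C * (t * (1 - t) * enorm (x - y) ^+ 2)).
  apply: ler_wpM2l => //.
  have nle : `|x - y| ^+ 2 <= enorm (x - y) ^+ 2.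
    by rewrite lerXn2r ?nnegrE ?enorm_ge0 ?norm_le_enorm.
  by have := ler_wpM2l (mulr_ge0 C0 (mulr_ge0 t0 t1')) nle; lra.
have := mulr_ge0 (mulr_ge0 t0 t1') (sqr_ge0 (enorm (x - y))).
lra.
Qed.
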